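(* Let $P\in\mathcal P(\mathcal X)$, $E\ge 0$ and $0\le \Delta\le \Delta_{\max}:=\min_{y\in\mathcal Y}\sum_{x\in\mathcal X}P(x)d(x,y)$. Then $$R_{\rm M}(E\mid\Delta,P)=\sup_{\nu\ge 0}\ \inf_{\mu\ge 0}\Big[-\nu\Delta+\mu E+\min_{p_Y\in\mathcal P(\mathcal Y)}G^{(\mu,\nu)}(p_Y\mid P)\Big].$$
   Context: $\mathcal X,\mathcal Y$ are finite nonempty sets; $\mathcal P(\mathcal X)$ denotes the set of probability distributions on $\mathcal X$ (similarly $\mathcal P(\mathcal Y)$), and $\mathcal P(\mathcal Y|\mathcal X)$ the set of conditional distributions of $\mathcal Y$ given $\mathcal X$. A distortion measure $d:\mathcal X\times\mathcal Y\to[0,\infty)$ is given with $\max_{x}\min_{y}d(x,y)=0$. Logarithms are natural. For $q\in\mathcal P(\mathcal X)$ and $\Delta\ge0$ the rate-distortion function is $R(\Delta\mid q)=\min\{I(q,V):V\in\mathcal P(\mathcal Y|\mathcal X),\ \sum_{x,y}q(x)V(y|x)d(x,y)\le\Delta\}$, where $I(q,V)$ is the mutual information. $D(q\|P)$ is the relative entropy. The inverse Marton function is $R_{\rm M}(E\mid\Delta,P)=\max\{R(\Delta\mid q_X): q_X\in\mathcal P(\mathcal X),\ D(q_X\|P)\le E\}$. For $\mu,\nu\ge0$, $p_Y\in\mathcal P(\mathcal Y)$: $G^{(\mu,\nu)}(p_Y\mid P)=\mu\log\sum_x P(x)\big(\sum_y p_Y(y)e^{-\nu d(x,y)}\big)^{-1/\mu}$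 if $\mu>0$, and $G^{(0,\nu)}(p_Y\mid P)=-\log\min_{x\in\mathcal X}\sum_y p_Y(y)e^{-\nu d(x,y)}$. *)

(* Defs.v *)
From HB Require Import structures.
From mathcomp Require Import all_boot all_order all_algebra.
From mathcomp Require Import all_classical all_reals all_analysis.
Set Implicit Arguments. Unset Strict Implicit. Unset Printing Implicit Defensive.
Import Order.TTheory GRing.Theory Num.Theory.
Local Open Scope classical_set_scope.
Local Open Scope ring_scope.

Section RD.
Variables (R : realType) (X Y : finType).

Definition is_distr (T : finType) (p : T -> R) : Prop :=
  (forall t, 0 <= p t) /\ \sum_(t : T) p t = 1.

Definition is_cond_distr (V : X -> Y -> R) : Prop := forall x, is_distr (V x).

Definition out_distr (q : X -> R) (V : X -> Y -> R) (y : Y) : R :=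
  \sum_(x : X) q x * V x y.

Definition mutual_info (q : X -> R) (V : X -> Y -> R) : R :=
  \sum_(x : X) \sum_(y : Y)
    (if q x * V x y == 0 then 0
     else q x * V x y * ln (V x y / out_distr q V y)).

Definition rel_entropy (q P : X -> R) : \bar R :=
  (\sum_(x : X)
     (if q x == 0%R then 0%E
      else if P x == 0%R then +oo%E
      else (q x * ln (q x / P x))%R%:E))%E.

Definition avg_dist (d : X -> Y -> R) (q : X -> R) (V : X -> Y -> R) : R :=
  \sum_(x : X) \sum_(y : Y) q x * V x y * d x y.

(* rate-distortion function R(Delta | q) (a minimum, written as an infimum) *)
Definition rate_dist (d : X -> Y -> R) (Delta : R) (q : X -> R) : \bar R :=
  ereal_inf [set (mutual_info q V)%:E |
             V in [set V | is_cond_distr V /\ avg_dist d q V <= Delta]].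

(* inverse Marton function R_M(E | Delta, P) (a maximum, written as sup) *)
Definition inv_marton (d : X -> Y -> R) (E Delta : R) (P : X -> R) : \bar R :=
  ereal_sup [set rate_dist d Delta q |
             q in [set q | is_distr q /\ (rel_entropy q P <= E%:E)%E]].

Definition inner_sum (d : X -> Y -> R) (nu : R) (pY : Y -> R) (x : X) : R :=
  \sum_(y : Y) pY y * expR (- (nu * d x y)).

Definition Gfun (d : X -> Y -> R) (mu nu : R) (pY : Y -> R) (P : X -> R) : R :=
  if 0 < mu then
    mu * ln (\sum_(x : X) P x * powR (inner_sum d nu pY x) (- mu^-1))
  else
    - ln (fine (ereal_inf [set (inner_sum d nu pY x)%:E | x in [set: X]])).

Definition Delta_max (d : X -> Y -> R) (P : X -> R) : \bar R :=
  ereal_inf [set (\sum_(x : X) P x * d x y)%:E | y in [set: Y]].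

Definition maxmin_dist (d : X -> Y -> R) : \bar R :=
  ereal_sup [set ereal_inf [set (d x y)%:E | y in [set: Y]] | x in [set: X]].

Definition dual_expr (d : X -> Y -> R) (E Delta : R) (P : X -> R) : \bar R :=
  ereal_sup [set
    ereal_inf [set
      ((- (nu * Delta) + mu * E)%:E
        + ereal_inf [set (Gfun d mu nu pY P)%:E | pY in [set pY | is_distr pY]])%E
      | mu in [set mu : R | 0 <= mu]]
    | nu in [set nu : R | 0 <= nu]].

End RD.

(* Main.v *)
Require Import Defs.
From HB Require Import structures.
From mathcomp Require Import all_boot all_order all_algebra.
From mathcomp Require Import all_classical all_reals all_analysis.
From mathcomp Require Import ring lra.
Import Order.TTheory GRing.Theory Num.Theory.
Import numFieldNormedType.Exports.
Local Open Scope classical_set_scope.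
Local Open Scope ring_scope.

(* Write F_nu(q, p) = - sum_x q(x) log sum_y p(y) exp(-nu d(x, y)).  For fixed q,
   min_p F_nu(q, p) = min_V [I(q, V) + nu E d], so Lagrangian duality in the single
   distortion constraint gives R(Delta | q) = sup_nu [- nu Delta + min_p F_nu(q, p)].
   R(. | q) need not be concave in q, but for fixed nu the function min_p F_nu(q, p) is,
   so once the suprema over q and nu are exchanged, a second Lagrange multiplier mu can
   be attached to the constraint D(q || P) <= E.  For mu > 0, the maximum over q of
   F_nu(q, p) - mu D(q || P) is G^(mu, nu)(p | P), attained at an exponentially tilted P
   (Gibbs variational principle); a minimiser p of G and its tilted q form a saddle point.
   When Delta = 0 or E = 0 no strictly feasible point exists, and the multiplier is
   instead sent to infinity. *)

(** * The scalar function v ln (v / p) *)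

Section KL.
Set Implicit Arguments. Unset Strict Implicit.
Variable R : realType.
Implicit Types v p c t : R.

(** For [v != 0] and [p = 0] the value is the default [v * ln 0 = 0], not infinity; hence the
    hypotheses [v != 0 -> p != 0] below. *)
Definition kl v p : R := if v == 0 then 0 else v * ln (v / p).

Lemma ln_le_sub1 c : 0 < c -> ln c <= c - 1.
Proof. by move=> c0; have := expR_ge1Dx (ln c); rewrite lnK ?posrE//; lra. Qed.

(* The tangent to [kl] along the ray [v = c * p]. *)
Lemma kl_ge v p c : 0 <= v -> 0 <= p -> (v != 0 -> p != 0) -> 0 < c ->
  v * ln c + v - c * p <= kl v p.
Proof.
move=> v0 p0 vp c0; rewrite /kl; case: eqVneq => [->|vN0].
  by have := mulr_ge0 (ltW c0) p0; lra.
have {}p0 : 0 < p by rewrite lt_def vp.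
have {}v0 : 0 < v by rewrite lt_def vN0.
have cpv0 : 0 < c * p / v by rewrite divr_gt0 ?mulr_gt0.
have -> : v / p = c / (c * p / v).
  by field; rewrite !gt_eqF.
rewrite ln_div ?posrE// mulrBr.
have := ler_wpM2l (ltW v0) (ln_le_sub1 cpv0).
have -> : v * (c * p / v - 1) = c * p - v by field.
lra.
Qed.

(** The tangents for [c = v / p], the ratio at the mixed point, bound both terms on the right from
    below, and their mixture equals the left-hand side. *)
Lemma kl_convex t v1 v2 p1 p2 : 0 <= t <= 1 ->
  0 <= v1 -> 0 <= v2 -> 0 <= p1 -> 0 <= p2 ->
  (v1 != 0 -> p1 != 0) -> (v2 != 0 -> p2 != 0) ->
  kl (t * v1 + (1 - t) * v2) (t * p1 + (1 - t) * p2)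
    <= t * kl v1 p1 + (1 - t) * kl v2 p2.
Proof.
move=> /andP[t0 t1] v10 v20 p10 p20 vp1 vp2.
have s0 : 0 <= 1 - t by lra.
set v := t * v1 + _; set p := t * p1 + _.
have v0 : 0 <= v by rewrite addr_ge0 ?mulr_ge0.
case: (eqVneq v 0) => [v_eq0|vN0].
  have z (s a b : R) : 0 <= s -> s * a = 0 -> 0 <= a -> 0 <= b -> (a != 0 -> b != 0) ->
      0 <= s * kl a b.
    move=> sg /eqP; rewrite mulf_eq0 => /orP[]/eqP-> *; first by rewrite mul0r.
    by rewrite /kl eqxx mulr0.
  have a1 := mulr_ge0 t0 v10; have a2 := mulr_ge0 s0 v20.
  rewrite {1}/kl v_eq0 eqxx addr_ge0// z//; move: v_eq0; rewrite /v; lra.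
have p0 : 0 < p.
  rewrite lt_def; apply/andP; split; last by rewrite addr_ge0 ?mulr_ge0.
  apply/eqP => p_eq0; move/eqP: vN0; apply.
  have a1 := mulr_ge0 t0 p10; have a2 := mulr_ge0 s0 p20.
  have e1 : t * p1 = 0 by move: p_eq0; rewrite /p; lra.
  have e2 : (1 - t) * p2 = 0 by move: p_eq0; rewrite /p; lra.
  have f (s a b : R) : s * b = 0 -> (a != 0 -> b != 0) -> s * a = 0.
    move=> /eqP; rewrite mulf_eq0 => /orP[/eqP->|b0 ab]; first by rewrite mul0r.
    by case: (eqVneq a 0) => [->|/ab]; rewrite ?mulr0 ?b0.
  by rewrite /v (f _ _ _ e1 vp1) (f _ _ _ e2 vp2) addr0.
have c0 : 0 < v / p by rewrite divr_gt0 // lt_def vN0.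
have /(ler_wpM2l t0) h1 := kl_ge v10 p10 vp1 c0.
have /(ler_wpM2l s0) h2 := kl_ge v20 p20 vp2 c0.
rewrite {1}/kl (negbTE vN0).
apply: le_trans (lerD h1 h2).
have e : v - v / p * p = 0 by rewrite divfK ?gt_eqF// subrr.
rewrite -[leLHS]addr0 -e /v /p; set L := ln _; set c := _ / _.
by rewrite le_eqVlt; apply/orP; left; apply/eqP; ring.
Qed.

End KL.

(** * Mutual information and Gibbs channels *)

Section MutualInformation.
Set Implicit Arguments. Unset Strict Implicit.
Variables (R : realType) (X Y : finType).
Implicit Types (q : X -> R) (p : Y -> R) (V k d : X -> Y -> R).

Lemma sum_mono_mul (T : finType) (w f g : T -> R) :
  (forall t, 0 <= w t) -> (forall t, w t != 0 -> f t <= g t) ->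
  \sum_t w t * f t <= \sum_t w t * g t.
Proof.
move=> w0 fg; apply: ler_sum => t _; have [->|wt] := eqVneq (w t) 0.
  by rewrite !mul0r.
by rewrite ler_wpM2l ?fg.
Qed.

Lemma point_mass_is_distr (T : finType) (t0 : T) :
  is_distr (fun t => (t == t0)%:R : R).
Proof.
split=> [t|]; first by rewrite ler0n.
by rewrite (bigD1 t0)//= eqxx big1 ?addr0// => t /negbTE ->.
Qed.

Lemma distr_neq0 (T : finType) (w : T -> R) : is_distr w -> exists t, w t != 0.
Proof.
move=> dw; apply/existsP; rewrite -negb_forall; apply/negP => /forallP w0.
have := dw.2; rewrite big1 => [/eqP|t _]; first by rewrite eq_sym oner_eq0.
exact/eqP/w0.
Qed.

Lemma distr_sum_gt0 (T : finType) (w f : T -> R) :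
  is_distr w -> (forall t, 0 < f t) -> 0 < \sum_t w t * f t.
Proof.
move=> dw f0; have [t wt] := distr_neq0 dw.
rewrite (bigD1 t)//= ltr_pwDl//.
  by rewrite mulr_gt0// lt_def wt dw.1.
by apply: sumr_ge0 => z _; rewrite mulr_ge0 ?dw.1// ltW.
Qed.

Lemma out_distr_ge0 q V y :
  is_distr q -> is_cond_distr V -> 0 <= out_distr q V y.
Proof. by move=> [q0 _] cV; apply: sumr_ge0 => x _; rewrite mulr_ge0 ?(cV x).1. Qed.

Lemma out_distr_is_distr q V :
  is_distr q -> is_cond_distr V -> is_distr (out_distr q V).
Proof.
move=> dq cV; split=> [y|]; first exact: out_distr_ge0.
rewrite exchange_big /= -[RHS]dq.2; apply: eq_bigr => x _.
by rewrite -mulr_sumr (cV x).2 mulr1.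
Qed.

Lemma out_distr_neq0 q V x y : is_distr q -> is_cond_distr V ->
  q x != 0 -> V x y != 0 -> out_distr q V y != 0.
Proof.
move=> dq cV qx Vxy; rewrite gt_eqF//.
apply: (@lt_le_trans _ _ (q x * V x y)).
  by rewrite mulr_gt0 // lt_def ?qx ?Vxy ?dq.1 ?(cV x).1.
rewrite /out_distr (bigD1 x)//= lerDl.
by apply: sumr_ge0 => z _; rewrite mulr_ge0 ?dq.1 ?(cV z).1.
Qed.

Lemma mutual_infoE q V : mutual_info q V =
  \sum_x q x * \sum_y kl (V x y) (out_distr q V y).
Proof.
apply: eq_bigr => x _; rewrite mulr_sumr; apply: eq_bigr => y _.
rewrite /kl mulf_eq0; case: eqVneq => [->|_] /=; first by rewrite mul0r.
by case: eqVneq => _; rewrite ?mulr0 ?mulrA.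
Qed.

(** The gap is the relative entropy of the output distribution [r] from [p]; it is nonnegative by
    the tangent bound with [c = V x y / r y], summed over x and y. *)
Lemma mutual_info_le_kl q V p : is_distr q -> is_cond_distr V -> is_distr p ->
  (forall x y, V x y != 0 -> p y != 0) ->
  mutual_info q V <= \sum_x q x * \sum_y kl (V x y) (p y).
Proof.
move=> dq cV dp Vp; rewrite mutual_infoE.
pose r := out_distr q V.
have term x y : q x * kl (V x y) (r y) + q x * V x y - p y * (q x * V x y / r y)
    <= q x * kl (V x y) (p y).
  have [->|qx] := eqVneq (q x) 0; first by rewrite !mul0r mulr0; lra.
  have [V0|Vxy] := eqVneq (V x y) 0.
    by rewrite /kl V0 eqxx; lra.
  have r0 : 0 < r y by rewrite lt_def out_distr_ge0// (@out_distr_neq0 q V x).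
  have V0 : 0 < V x y by rewrite lt_def Vxy (cV x).1.
  have := kl_ge (ltW V0) (dp.1 y) (Vp x y) (divr_gt0 V0 r0).
  move=> /(ler_wpM2l (dq.1 x)); apply: le_trans; rewrite {1}/kl (negbTE Vxy).
  by rewrite le_eqVlt; apply/orP; left; apply/eqP; ring.
have qV1 : \sum_x \sum_y q x * V x y = 1.
  rewrite -[RHS]dq.2; apply: eq_bigr => x _.
  by rewrite -mulr_sumr (cV x).2 mulr1.
have pr1 : \sum_x \sum_y p y * (q x * V x y / r y) <= 1.
  rewrite exchange_big /= -[leRHS]dp.2; apply: ler_sum => y _.
  rewrite -mulr_sumr -mulr_suml -[leRHS]mulr1 ler_wpM2l ?dp.1//.
  (* A letter with [r y = 0] contributes 0 by the convention on division, so the total is only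
     bounded by 1. *)
  rewrite -/(out_distr q V y) -/r; have [->|ry] := eqVneq (r y) 0.
    by rewrite mul0r.
  by rewrite divff.
under eq_bigr do rewrite mulr_sumr.
under [leRHS]eq_bigr do rewrite mulr_sumr.
have : \sum_x \sum_y (q x * kl (V x y) (r y) + q x * V x y
    - p y * (q x * V x y / r y)) <= \sum_x \sum_y q x * kl (V x y) (p y).
  by apply: ler_sum => x _; apply: ler_sum => y _; exact: term.
under [X in X <= _ -> _]eq_bigr do rewrite sumrB big_split/=.
rewrite sumrB big_split/= qV1; lra.
Qed.

Lemma mutual_info_convex q V1 V2 t : 0 <= t <= 1 ->
  is_distr q -> is_cond_distr V1 -> is_cond_distr V2 ->
  mutual_info q (fun x y => t * V1 x y + (1 - t) * V2 x y)
    <= t * mutual_info q V1 + (1 - t) * mutual_info q V2.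
Proof.
move=> t01 dq c1 c2; rewrite !mutual_infoE !mulr_sumr -big_split/=.
rewrite [leRHS](eq_bigr (fun x => q x * (\sum_y (t * kl (V1 x y) (out_distr q V1 y)
    + (1 - t) * kl (V2 x y) (out_distr q V2 y))))).
  apply: sum_mono_mul; first exact: dq.1.
  move=> x qx; apply: ler_sum => y _.
  have -> : out_distr q (fun x y => t * V1 x y + (1 - t) * V2 x y) y
      = t * out_distr q V1 y + (1 - t) * out_distr q V2 y.
    rewrite /out_distr !mulr_sumr -big_split/=; apply: eq_bigr => z _; ring.
  apply: kl_convex => //; rewrite ?out_distr_ge0 ?(c1 x).1 ?(c2 x).1//;
    exact: out_distr_neq0.
by move=> x _; rewrite big_split/= -!mulr_sumr; ring.
Qed.

(** The kernel [k] is left general: it is taken to be exp(-nu d), and also the indicator of d = 0,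
    its limit as nu grows. *)
Definition gibbs_channel k p x y : R := p y * k x y / \sum_z p z * k x z.

Lemma gibbs_channel_cond_distr k p : is_distr p -> (forall x y, 0 <= k x y) ->
  (forall x, 0 < \sum_y p y * k x y) -> is_cond_distr (gibbs_channel k p).
Proof.
move=> dp k0 S0 x; split=> [y|].
  by rewrite divr_ge0 ?mulr_ge0 ?dp.1// ltW.
by rewrite -mulr_suml divff ?gt_eqF.
Qed.

Lemma mutual_info_gibbs_channel q k p : is_distr q -> is_distr p ->
  (forall x y, 0 <= k x y) -> (forall x, 0 < \sum_y p y * k x y) ->
  mutual_info q (gibbs_channel k p) <=
    (\sum_x \sum_y q x * gibbs_channel k p x y * ln (k x y))
    - \sum_x q x * ln (\sum_y p y * k x y).
Proof.
move=> dq dp k0 S0; have cV := gibbs_channel_cond_distr dp k0 S0.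
have VN0 x y : gibbs_channel k p x y != 0 -> p y != 0.
  by apply: contraNneq => p0; rewrite /gibbs_channel p0 !mul0r.
apply: le_trans (mutual_info_le_kl dq cV dp VN0) _.
rewrite -sumrB; apply: ler_sum => x _.
under [X in _ <= X - _]eq_bigr do rewrite -mulrA.
rewrite -mulr_sumr -mulrBr ler_wpM2l ?dq.1//.
rewrite -[X in _ - X]mul1r -(cV x).2 mulr_suml -sumrB.
apply: ler_sum => y _; rewrite /kl; case: eqVneq => [->|Vxy].
  by rewrite !mul0r subr0.
have p0 := VN0 _ _ Vxy.
have kxy : k x y != 0.
  by apply: contra_neq Vxy => kE; rewrite /gibbs_channel kE mulr0 mul0r.
have -> : gibbs_channel k p x y / p y = k x y / \sum_z p z * k x z.
  by rewrite /gibbs_channel; field; rewrite p0 gt_eqF.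
by rewrite ln_div ?posrE ?S0// ?mulrBr// lt_def kxy k0.
Qed.

Definition cross_info d nu q p : R := - \sum_x q x * ln (inner_sum d nu p x).

Lemma inner_sum_gt0 d nu p x : is_distr p -> 0 < inner_sum d nu p x.
Proof. by move=> dp; apply: distr_sum_gt0 => // y; exact: expR_gt0. Qed.

Lemma inner_sum_le1 d nu p x : 0 <= nu -> (forall x y, 0 <= d x y) ->
  is_distr p -> inner_sum d nu p x <= 1.
Proof.
move=> nu0 d0 dp; rewrite -[leRHS]dp.2; apply: ler_sum => y _.
by rewrite ler_piMr ?dp.1// -expR0 ler_expR oppr_le0 mulr_ge0.
Qed.

Lemma cross_info_ge0 d nu q p : 0 <= nu -> (forall x y, 0 <= d x y) ->
  is_distr q -> is_distr p -> 0 <= cross_info d nu q p.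
Proof.
move=> nu0 d0 dq dp; rewrite /cross_info oppr_ge0; apply: sumr_le0 => x _.
by rewrite mulr_ge0_le0 ?dq.1// ln_le0// inner_sum_le1.
Qed.

(** The Gibbs channel with kernel exp(-nu d) is the witness. Through it, lower bounds over channels
    become lower bounds over [p]. *)
Lemma cross_info_gibbs_channel d nu q p : is_distr q -> is_distr p ->
  exists2 V, is_cond_distr V &
    mutual_info q V + nu * avg_dist d q V <= cross_info d nu q p.
Proof.
move=> dq dp; pose k x y := expR (- (nu * d x y)).
have k0 x y : 0 <= k x y by exact: expR_ge0.
have S0 x : 0 < \sum_y p y * k x y by exact: inner_sum_gt0.
exists (gibbs_channel k p); first exact: gibbs_channel_cond_distr.
have := mutual_info_gibbs_channel dq dp k0 S0.
suff -> : \sum_x \sum_y q x * gibbs_channel k p x y * ln (k x y)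
    = - (nu * avg_dist d q (gibbs_channel k p)).
  rewrite /cross_info /inner_sum -/k; lra.
rewrite /avg_dist mulr_sumr -sumrN; apply: eq_bigr => x _.
rewrite mulr_sumr -sumrN; apply: eq_bigr => y _.
by rewrite /k expRK; ring.
Qed.

(** Tangent bound with [c] = exp(-nu d(x, y)) / S, the value of V / r for the Gibbs channel built on
    [r]; summed over y, its linear terms cancel. *)
Lemma cross_info_le_info d nu q V : is_distr q -> is_cond_distr V ->
  cross_info d nu q (out_distr q V) <= mutual_info q V + nu * avg_dist d q V.
Proof.
move=> dq cV; rewrite mutual_infoE /avg_dist /cross_info mulr_sumr -sumrN -big_split/=.
have dr := out_distr_is_distr dq cV; set r := out_distr q V in dr *.
have -> : \sum_x - (q x * ln (inner_sum d nu r x)) =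
   \sum_x q x * - ln (inner_sum d nu r x) by under eq_bigr do rewrite -mulrN.
rewrite [leRHS](eq_bigr (fun x => q x * \sum_y (kl (V x y) (r y) + nu * V x y * d x y))); last first.
  move=> x _; rewrite big_split/= mulrDr; congr (_ + _).
  by rewrite !mulr_sumr; apply: eq_bigr => y _; ring.
apply: sum_mono_mul; first exact: dq.1.
move=> x qx; set S := inner_sum _ _ _ _.
have S0 : 0 < S by exact: inner_sum_gt0.
have : \sum_y (V x y * - ln S + V x y - r y * expR (- (nu * d x y)) / S)
   <= \sum_y (kl (V x y) (r y) + nu * V x y * d x y).
  apply: ler_sum => y _.
  have c0 : 0 < expR (- (nu * d x y)) / S by rewrite divr_gt0 ?expR_gt0.
  have := kl_ge ((cV x).1 y) (dr.1 y) (out_distr_neq0 dq cV qx) c0.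
  rewrite ln_div ?posrE ?expR_gt0// expRK.
  set e := expR _; have -> : r y * e / S = e / S * r y by ring.
  lra.
rewrite sumrB big_split/= -!mulr_suml (cV x).2 -/(inner_sum d nu r x) -/S.
rewrite divff ?gt_eqF//; lra.
Qed.

Lemma mutual_info_ge0 q V : is_distr q -> is_cond_distr V -> 0 <= mutual_info q V.
Proof.
move=> dq cV; have dr := out_distr_is_distr dq cV.
have := @cross_info_le_info (fun _ _ => 0) 0 q V dq cV; rewrite mul0r addr0.
by apply: le_trans; apply: cross_info_ge0.
Qed.

End MutualInformation.

(** * Lagrange multiplier for one convex constraint *)

Section Lagrange.
Set Implicit Arguments. Unset Strict Implicit.

(** Convexity is phrased by the existence of a point [k], so one statement serves both channels and
    input distributions. The multiplier separates the slopes seen from infeasible points from those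
    seen from strictly feasible ones. *)
Lemma lagrange_multiplier (R : realType) (T : Type) (K : set T) (f g : T -> R)
    (delta c : R) (k0 : T) :
  (forall t k1 k2, 0 <= t <= 1 -> K k1 -> K k2 -> exists2 k, K k &
     f k <= t * f k1 + (1 - t) * f k2 /\ g k <= t * g k1 + (1 - t) * g k2) ->
  K k0 -> g k0 < delta ->
  (forall k, K k -> g k <= delta -> c <= f k) ->
  exists2 nu, 0 <= nu & forall k, K k -> c <= f k + nu * (g k - delta).
Proof.
move=> conv K0 g0 cf.
(* Lower bounds that infeasible points impose on the multiplier; adjoining 0 makes the supremum
   nonnegative. *)
pose A := [set 0] `|` [set (c - f k) / (g k - delta) | k in K `&` [set k | delta < g k]].
have ubA k1 : K k1 -> g k1 < delta -> ubound A ((f k1 - c) / (delta - g k1)).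
  move=> K1 g1 _ [->|[k2 [K2 /= g2] <-]].
    by rewrite divr_ge0// subr_ge0 ?cf// ltW.
  have [a aE] : exists a, a = delta - g k1 by eexists.
  have [b bE] : exists b, b = g k2 - delta by eexists.
  have a0 : 0 < a by rewrite aE subr_gt0.
  have b0 : 0 < b by rewrite bE subr_gt0.
  rewrite -aE -bE.
  have ab0 : 0 < a + b by rewrite addr_gt0.
  (* With these weights the mixed value of [g] is exactly [delta]. *)
  have t01 : 0 <= b / (a + b) <= 1.
    by rewrite ler_pdivrMr// mul1r lerDr (ltW a0) divr_ge0// ltW.
  have [k Kk [fk gk]] := conv _ _ _ t01 K1 K2.
  have /(cf _ Kk)/le_trans/(_ fk) : g k <= delta.
    apply: le_trans gk _; rewrite le_eqVlt; apply/orP; left; apply/eqP.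
    have -> : g k1 = delta - a by rewrite aE; ring.
    have -> : g k2 = delta + b by rewrite bE; ring.
    by field; rewrite gt_eqF.
  have -> : b / (a + b) * f k1 + (1 - b / (a + b)) * f k2 = (b * f k1 + a * f k2) / (a + b).
    by field; rewrite gt_eqF.
  rewrite ler_pdivlMr// => h.
  rewrite ler_pdivrMr// mulrAC ler_pdivlMr//; lra.
have A0 : A 0 by left.
have hubA : has_ubound A by exists ((f k0 - c) / (delta - g k0)); exact: ubA.
exists (sup A); first exact: ub_le_sup.
move=> k Kk; case: (ltgtP (g k) delta) => [glt|ggt|gE].
- have : sup A <= (f k - c) / (delta - g k) by apply: ge_sup; [exists 0|exact: ubA].
  rewrite ler_pdivlMr ?subr_gt0//; lra.
- have : (c - f k) / (g k - delta) <= sup A.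
    by apply: ub_le_sup => //; right; exists k.
  rewrite ler_pdivrMr ?subr_gt0//; lra.
- by rewrite gE subrr mulr0 addr0 cf// gE.
Qed.

End Lagrange.

(** * Multiplier for the distortion constraint *)

Section RateDistortion.
Set Implicit Arguments. Unset Strict Implicit.
Variables (R : realType) (X Y : finType) (d : X -> Y -> R).
Hypothesis d_ge0 : forall x y, 0 <= d x y.
Hypothesis d_eq0 : forall x, exists y, d x y = 0.
Variable q : X -> R.
Hypothesis dq : is_distr q.

Lemma zero_distortion_channel : exists2 V, is_cond_distr V & avg_dist d q V = 0.
Proof.
have [h h0] : exists h, forall x, d x (h x) = 0.
  by have [h] := choice d_eq0; exists h.
exists (fun x y => (y == h x)%:R); first by move=> x; exact: point_mass_is_distr.
rewrite /avg_dist big1// => x _; rewrite big1// => y _.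
by case: eqP => [->|_]; rewrite ?h0 mulr0 ?mul0r.
Qed.

(* Without a channel of distortion < 0, [lagrange_multiplier] does not apply. For nu large,
   exp(-nu d) is at most [d = 0] + eta with eta small, and mixing [p] with a little of the
   uniform distribution absorbs [eta]. *)
Lemma rate_dist_multiplier_zero (c e : R) : 0 < e -> (0 < #|Y|)%N ->
  (forall V, is_cond_distr V -> avg_dist d q V <= 0 -> c <= mutual_info q V) ->
  exists2 nu, 0 <= nu &
    forall p, is_distr p -> c - e <= cross_info d nu q p.
Proof.
move=> e0 HY cI.
(* Weight of the uniform distribution, chosen so that ln (1 - s) = -e is exactly the permitted loss;
   [eta] is its share per letter. *)
pose s := 1 - expR (- e).
have s0 : 0 < s by rewrite subr_gt0 -expR0 ltr_expR oppr_lt0.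
have s1 : s < 1 by rewrite gtrBl expR_gt0.
have Y0 : 0 < #|Y|%:R :> R by rewrite ltr0n.
pose eta := s / #|Y|%:R.
have eta0 : 0 < eta by rewrite divr_gt0.
have eta1 : eta <= 1.
  rewrite ler_pdivrMr// mul1r (le_trans (ltW s1))//.
  by rewrite -[1]/(1%:R) ler_nat.
(* [w x y] solves exp(-w d) = eta when d > 0; [nu] dominates them all. *)
pose w x y : R := if d x y == 0 then 0 else - ln eta / d x y.
have w0 x y : 0 <= w x y.
  rewrite /w; case: ifP => // _.
  by rewrite divr_ge0// oppr_ge0 ln_le0.
pose nu := \sum_x \sum_y w x y.
have nu0 : 0 <= nu by apply: sumr_ge0 => x _; apply: sumr_ge0.
have wnu x y : w x y <= nu.
  rewrite /nu (bigD1 x)//= (bigD1 y)//= -addrA lerDl addr_ge0 ?sumr_ge0//.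
  by move=> z _; rewrite sumr_ge0.
pose k x y : R := (d x y == 0)%:R.
have k0 x y : 0 <= k x y by rewrite ler0n.
have expk x y : expR (- (nu * d x y)) <= k x y + eta.
  rewrite /k; have [->|dN0] := eqVneq (d x y) 0.
    by rewrite mulr0 oppr0 expR0 lerDl ltW.
  rewrite add0r -[leRHS]lnK ?posrE// ler_expR.
  have := wnu x y; rewrite /w (negbTE dN0) ler_pdivrMr ?lt_def ?dN0 ?d_ge0//; lra.
exists nu => // p dp.
pose p' y := (1 - s) * p y + eta.
have s1' : 0 <= 1 - s by rewrite subr_ge0 ltW.
have p'0 y : 0 <= p' y.
  by apply: addr_ge0; [exact: mulr_ge0 s1' (dp.1 y)|exact: ltW].
have dp' : is_distr p'.
  split=> //; rewrite big_split/= -mulr_sumr dp.2 sumr_const -mulr_natr /eta.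
  by rewrite -mulrA mulVf ?gt_eqF//; ring.
have Sk x : (1 - s) * inner_sum d nu p x <= \sum_y p' y * k x y.
  have kx : 1 <= \sum_y k x y.
    have [y dy] := d_eq0 x.
    by rewrite (bigD1 y)//= /k dy eqxx lerDl sumr_ge0.
  have h1 : inner_sum d nu p x <= \sum_y p y * k x y + eta.
    rewrite -[X in _ <= _ + X]mul1r -dp.2 mulr_suml -big_split/=.
    by apply: ler_sum => y _; rewrite -mulrDr ler_wpM2l ?dp.1.
  have -> : \sum_y p' y * k x y = (1 - s) * (\sum_y p y * k x y) + eta * \sum_y k x y.
    by rewrite !mulr_sumr -big_split/=; apply: eq_bigr => y _; rewrite /p'; ring.
  have := ler_wpM2l (ltW eta0) kx.
  have := ler_wpM2l s1' h1; have := mulr_gt0 s0 eta0; lra.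
have S0 x : 0 < \sum_y p' y * k x y.
  by apply: lt_le_trans (Sk x); rewrite mulr_gt0 ?subr_gt0// inner_sum_gt0.
(* With the indicator kernel, the Gibbs channel uses only letters of zero distortion, so it is
   feasible and the ln k term vanishes. *)
have Vd x y : gibbs_channel k p' x y != 0 -> d x y = 0 /\ k x y = 1.
  rewrite /gibbs_channel /k; case: (eqVneq (d x y) 0) => // _.
  by rewrite mulr0 mul0r eqxx.
have I1 := mutual_info_gibbs_channel dq dp' k0 S0.
have : c <= mutual_info q (gibbs_channel k p').
  apply: cI; first exact: gibbs_channel_cond_distr.
  rewrite /avg_dist big1// => x _; rewrite big1// => y _.
  by have [->|/Vd[-> _]] := eqVneq (gibbs_channel k p' x y) 0; rewrite !mulr0 ?mul0r.
move/le_trans => /(_ _ I1); rewrite big1 => [|x _]; last first.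
  rewrite big1// => y _.
  have [->|/Vd[_ ->]] := eqVneq (gibbs_channel k p' x y) 0; first by rewrite mulr0 mul0r.
  by rewrite ln1 mulr0.
rewrite sub0r lerBlDr => /le_trans; apply.
rewrite /cross_info -[X in _ + X]mul1r -dq.2 mulr_suml -!sumrN -big_split/=.
apply: ler_sum => x _; rewrite -mulrN -[- (q x * _)]mulrN -mulrDr ler_wpM2l ?dq.1//.
have i0 : 0 < inner_sum d nu p x by exact: inner_sum_gt0.
have : ln ((1 - s) * inner_sum d nu p x) <= ln (\sum_y p' y * k x y).
  by rewrite ler_ln ?posrE ?mulr_gt0 ?subr_gt0.
rewrite lnM ?posrE ?subr_gt0//.
have -> : 1 - s = expR (- e) by rewrite /s; ring.
rewrite expRK; lra.
Qed.

(** For [Delta > 0] the zero-distortion channel is strictly feasible, and the Gibbs channel of [p]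
    carries the Lagrangian bound over to [p]. The slack [e] pays for [Delta = 0]. *)
Lemma rate_dist_multiplier (Delta c e : R) : 0 <= Delta -> 0 < e -> (0 < #|Y|)%N ->
  (forall V, is_cond_distr V -> avg_dist d q V <= Delta -> c <= mutual_info q V) ->
  exists2 nu, 0 <= nu &
    forall p, is_distr p -> c - e <= cross_info d nu q p - nu * Delta.
Proof.
rewrite le_eqVlt => /orP[/eqP<- e0 HY|D0 e0 _] cI.
  have [nu nu0 h] := rate_dist_multiplier_zero e0 HY cI.
  by exists nu => // p dp; rewrite mulr0 subr0 h.
have [V0 cV0 V0d] := zero_distortion_channel.
have [||||nu nu0 h] := @lagrange_multiplier R _ [set V | is_cond_distr V]
    (mutual_info q) (avg_dist d q) Delta c V0 => //.
- move=> t V1 V2 /[dup] t01 /andP[t0 t1] c1 c2.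
  exists (fun x y => t * V1 x y + (1 - t) * V2 x y).
    move=> x; split=> [y|]; last first.
      by rewrite big_split/= -!mulr_sumr (c1 x).2 (c2 x).2; ring.
    by rewrite addr_ge0 ?mulr_ge0 ?(c1 x).1 ?(c2 x).1// subr_ge0.
  split; first exact: mutual_info_convex.
  rewrite /avg_dist !mulr_sumr -big_split/=; apply: ler_sum => x _.
  rewrite !mulr_sumr -big_split/=; apply: ler_sum => y _.
  by rewrite le_eqVlt; apply/orP; left; apply/eqP; ring.
- by rewrite V0d.
exists nu => // p dp.
have [V cV hV] := cross_info_gibbs_channel d nu dq dp.
have := h _ cV; lra.
Qed.

End RateDistortion.

(** * Relative entropy and the Gibbs variational principle *)

Section RelativeEntropy.
Set Implicit Arguments. Unset Strict Implicit.
Variables (R : realType) (X : finType) (P : X -> R).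
Hypothesis dP : is_distr P.
Implicit Types (q a : X -> R) (mu E : R).

(** A real-valued stand-in for [rel_entropy], meaningful only together with [abs_cont]. *)
Definition kl_div q : R := \sum_x kl (q x) (P x).

Definition abs_cont q : Prop := forall x, q x != 0 -> P x != 0.

Lemma rel_entropy_le q E :
  (rel_entropy q P <= E%:E)%E <-> abs_cont q /\ kl_div q <= E.
Proof.
have [qP|qP] := pselect (abs_cont q).
  have -> : rel_entropy q P = (kl_div q)%:E.
    rewrite /rel_entropy /kl_div -sumEFin; apply: eq_bigr => x _; rewrite /kl.
    by case: eqVneq => [//|/qP /negbTE ->].
  by rewrite lee_fin; split=> [|[]].
have /existsNP[x /not_implyP[qx Px]] : ~ forall x, q x != 0 -> P x != 0 by [].
split=> [|[]//].
rewrite (_ : rel_entropy q P = +oo%E)//.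
apply/eqP; rewrite esum_eqy => [|z _].
  by apply/existsP; exists x; rewrite (negbTE qx); move/negP/negPn: Px => ->.
by case: ifP => // _; case: ifP.
Qed.

Lemma kl_div_ge0 q : is_distr q -> abs_cont q -> 0 <= kl_div q.
Proof.
move=> dq qP; have : \sum_x (q x - P x) <= kl_div q.
  apply: ler_sum => x _.
  by have := kl_ge (dq.1 x) (dP.1 x) (qP x) ltr01; rewrite ln1 mulr0 add0r mul1r.
by rewrite sumrB dq.2 dP.2 subrr.
Qed.

Lemma kl_div_refl : kl_div P = 0.
Proof.
rewrite /kl_div big1// => x _; rewrite /kl; case: eqVneq => // Px.
by rewrite divff// ln1 mulr0.
Qed.

Lemma kl_div_convex q1 q2 t : 0 <= t <= 1 -> is_distr q1 -> is_distr q2 ->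
  abs_cont q1 -> abs_cont q2 ->
  kl_div (fun x => t * q1 x + (1 - t) * q2 x) <= t * kl_div q1 + (1 - t) * kl_div q2.
Proof.
move=> t01 d1 d2 ac1 ac2; rewrite /kl_div !mulr_sumr -big_split/=.
apply: ler_sum => x _.
have := kl_convex t01 (d1.1 x) (d2.1 x) (dP.1 x) (dP.1 x) (ac1 x) (ac2 x).
by rewrite -[X in kl _ X]mulrDl subrKC mul1r.
Qed.

Definition partition_fun a mu : R := \sum_x P x * expR (a x / mu).

Lemma partition_fun_gt0 a mu : 0 < partition_fun a mu.
Proof. by apply: distr_sum_gt0 => // x; exact: expR_gt0. Qed.

(** Tangent bound with [c] = exp(a / mu) / Z, the density of the tilted distribution with respect to
    [P]; equality therefore holds at [tilted]. *)
Lemma gibbs_variational q a mu : 0 < mu -> is_distr q -> abs_cont q ->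
  \sum_x q x * a x <= mu * kl_div q + mu * ln (partition_fun a mu).
Proof.
move=> mu0 dq qP; have Z0 := partition_fun_gt0 a mu.
have : \sum_x (q x * (a x / mu) - q x * ln (partition_fun a mu)
    + q x - P x * expR (a x / mu) / partition_fun a mu) <= kl_div q.
  apply: ler_sum => x _.
  have c0 : 0 < expR (a x / mu) / partition_fun a mu by rewrite divr_gt0 ?expR_gt0.
  have := kl_ge (dq.1 x) (dP.1 x) (qP x) c0.
  rewrite ln_div ?posrE ?expR_gt0// expRK.
  set e := expR _; set Z := partition_fun a mu.
  have -> : P x * e / Z = e / Z * P x by ring.
  lra.
rewrite sumrB big_split/= sumrB -!mulr_suml dq.2 divff ?gt_eqF//.
have -> : \sum_x q x * (a x / mu) = (\sum_x q x * a x) / mu.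
  by rewrite mulr_suml; apply: eq_bigr => x _; rewrite mulrA.
rewrite mul1r addrK lerBlDr ler_pdivrMr//.
by rewrite mulrDl [_ * mu]mulrC [X in _ + X]mulrC.
Qed.

Definition tilted a mu x : R := P x * expR (a x / mu) / partition_fun a mu.

Lemma tilted_is_distr a mu : is_distr (tilted a mu).
Proof.
have Z0 := partition_fun_gt0 a mu; split=> [x|].
  by rewrite divr_ge0 ?mulr_ge0 ?dP.1 ?expR_ge0// ltW.
by rewrite -mulr_suml divff ?gt_eqF.
Qed.

Lemma tilted_abs_cont a mu : abs_cont (tilted a mu).
Proof. by move=> x; apply: contraNneq => Px; rewrite /tilted Px !mul0r. Qed.

Lemma gibbs_variational_tilted a mu : 0 < mu ->
  \sum_x tilted a mu x * a x =
    mu * kl_div (tilted a mu) + mu * ln (partition_fun a mu).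
Proof.
move=> mu0; have Z0 := partition_fun_gt0 a mu.
rewrite -mulrDr -[X in _ + X]mul1r -(tilted_is_distr a mu).2 mulr_suml -big_split/=.
rewrite mulr_sumr; apply: eq_bigr => x _; rewrite /kl.
have [->|qx] := eqVneq (tilted a mu x) 0; first by rewrite !mul0r addr0 mulr0.
have -> : tilted a mu x / P x = expR (a x / mu) / partition_fun a mu.
  by rewrite /tilted; field; rewrite (tilted_abs_cont qx) gt_eqF.
by rewrite ln_div ?posrE ?expR_gt0// expRK; field; rewrite gt_eqF.
Qed.

(* [exp u - 1 <= u exp u] gives [mu ln Z <= exp (M / mu) * sum P a], which tends to [sum P a]. *)
Lemma partition_fun_large_mu a e : (forall x, 0 <= a x) -> 0 < e ->
  exists2 mu, 0 < mu & mu * ln (partition_fun a mu) <= \sum_x P x * a x + e.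
Proof.
move=> a0 e0; set F := \sum_x P x * a x.
have F0 : 0 <= F by apply: sumr_ge0 => x _; rewrite mulr_ge0 ?dP.1.
pose M := \sum_x a x + 1.
have M0 : 0 < M by rewrite ltr_wpDl ?sumr_ge0.
have aM x : a x <= M.
  by rewrite /M (bigD1 x)//= -addrA lerDl addr_ge0// sumr_ge0.
(* Chosen so that D * F <= F + e, with [F + 1] keeping the denominator positive; [mu = M / ln D]
   then gives exp(a / mu) <= D. *)
pose D := 1 + e / (F + 1).
have D1 : 1 < D by rewrite ltrDl divr_gt0// ltr_wpDl.
have lD0 : 0 < ln D by rewrite ln_gt0.
exists (M / ln D); first by rewrite divr_gt0.
set mu := M / ln D; have mu0 : 0 < mu by rewrite divr_gt0.
have expD x : expR (a x / mu) <= D.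
  have -> : D = expR (ln D) by rewrite lnK// posrE; lra.
  rewrite ler_expR /mu ler_pdivrMr// mulrCA divff ?gt_eqF// mulr1.
  exact: aM.
apply: (@le_trans _ _ (mu * (partition_fun a mu - 1))).
  by rewrite ler_pM2l// ln_le_sub1// partition_fun_gt0.
have -> : mu * (partition_fun a mu - 1) = \sum_x P x * (mu * (expR (a x / mu) - 1)).
  rewrite -{1}dP.2 /partition_fun -sumrB mulr_sumr; apply: eq_bigr => x _; ring.
apply: (@le_trans _ _ (D * F)).
  rewrite /F mulr_sumr; apply: ler_sum => x _.
  rewrite [leRHS]mulrCA ler_wpM2l ?dP.1//.
  apply: (@le_trans _ _ (expR (a x / mu) * a x)); last by rewrite ler_wpM2r.
  have := expR_ge1Dx (- (a x / mu)); rewrite expRN => /(ler_wpM2l (expR_ge0 (a x / mu))).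
  rewrite divff ?gt_eqF ?expR_gt0// => /(ler_wpM2l (ltW mu0)).
  set ex := expR _; have -> : mu * (ex * (1 - a x / mu)) = mu * ex - ex * a x.
    by field; rewrite gt_eqF.
  lra.
have : e / (F + 1) * F <= e.
  by rewrite mulrAC ler_pdivrMr ?ler_pM2l ?lerDl// ltr_wpDl.
rewrite /D; lra.
Qed.

End RelativeEntropy.

(** * Compactness of the probability simplex *)

Section Compactness.
Set Implicit Arguments. Unset Strict Implicit.
Variables (R : realType) (Y : finType).

Lemma cvg_sum_fin (T : Type) (F : set_system T) {FF : Filter F} (I : finType)
    (f : I -> T -> R) (l : I -> R) :
  (forall i, f i t @[t --> F] --> l i) ->
  (\sum_i f i t) @[t --> F] --> \sum_i l i.
Proof. by move=> fl; apply: cvg_big => //; exact: add_continuous. Qed.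

Lemma continuous_coord (y : Y) :
  continuous (fun p : prod_topology (fun _ : Y => R) => p y).
Proof. exact: (@proj_continuous Y (fun=> R) y). Qed.

Lemma is_distr_compact :
  compact ([set p | is_distr p] : set (prod_topology (fun _ : Y => R))).
Proof.
pose cube : set (prod_topology (fun _ : Y => R)) :=
  [set p | forall y, `[0, 1]%classic (p y)].
apply: (@subclosed_compact _ _ cube).
- have -> : [set p | is_distr p] =
      \bigcap_(y in setT) ((fun p : prod_topology (fun _ : Y => R) => p y) @^-1` [set r | 0 <= r])
      `&` ((fun p : prod_topology (fun _ : Y => R) => \sum_y p y) @^-1` [set r | r = 1]).
    apply/seteqP; split=> p /=.
      by move=> [p0 p1]; split=> [y _|]; [exact: p0|exact: p1].
    by move=> [p0 p1]; split=> // y; exact: p0.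
  apply: closedI.
    apply: closed_bigI => y _; apply: preimage_closed; last exact: closed_ge.
    by move=> p _; exact: continuous_coord.
  apply: preimage_closed; last exact: closed_eq.
  move=> p _; apply: (@cvg_sum_fin _ (nbhs p) _ Y (fun y p' => p' y) p) => y.
  exact: continuous_coord.
- by apply: (@tychonoff Y (fun=> R) (fun=> `[0, 1]%classic)) => y; exact: segment_compact.
- move=> p [p0 p1] y; rewrite /= in_itv/= p0 -p1 (bigD1 y)//= lerDl.
  by rewrite sumr_ge0.
Qed.

End Compactness.

(** * Saddle point and multiplier for the entropy constraint, at fixed nu *)

Section Saddle.
Set Implicit Arguments. Unset Strict Implicit.
Variables (R : realType) (X Y : finType) (d : X -> Y -> R).
Hypothesis d_ge0 : forall x y, 0 <= d x y.
Variable P : X -> R.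
Hypothesis dP : is_distr P.
Variable nu : R.
Hypothesis nu0 : 0 <= nu.
Hypothesis HY : (0 < #|Y|)%N.
Implicit Types (q : X -> R) (p : Y -> R).

(** The function of x whose mean under q is F_nu(q, p); the Gibbs principle is applied to it. *)
Definition neg_log_sum p x : R := - ln (inner_sum d nu p x).

Lemma cross_infoE q p : cross_info d nu q p = \sum_x q x * neg_log_sum p x.
Proof. by rewrite /cross_info -sumrN; apply: eq_bigr => x _; rewrite mulrN. Qed.

Lemma exists_distr : exists p : Y -> R, is_distr p.
Proof.
by have /card_gt0P[y0 _] := HY; exists (fun y => (y == y0)%:R); exact: point_mass_is_distr.
Qed.

Lemma neg_log_sum_ge0 p x : is_distr p -> 0 <= neg_log_sum p x.
Proof. by move=> dp; rewrite oppr_ge0 ln_le0// inner_sum_le1. Qed.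

Lemma Gfun_partition_fun mu p : 0 < mu -> is_distr p ->
  Gfun d mu nu p P = mu * ln (partition_fun P (neg_log_sum p) mu).
Proof.
move=> mu0 dp; rewrite /Gfun mu0; congr (_ * ln _); apply: eq_bigr => x _.
rewrite /powR gt_eqF ?inner_sum_gt0//; congr (_ * expR _).
by rewrite /neg_log_sum; ring.
Qed.

Lemma cross_info_le_Gfun0 q p : is_distr q -> is_distr p ->
  cross_info d nu q p <= Gfun d 0 nu p P.
Proof.
move=> dq dp; rewrite /Gfun ltxx cross_infoE.
have [x0 _] := distr_neq0 dq.
have [m _ mP] := @arg_minP _ R X x0 xpredT (inner_sum d nu p) isT.
(* The infimum over the finite alphabet is attained, so [fine] returns the true minimum. *)
rewrite (_ : ereal_inf _ = (inner_sum d nu p m)%:E); last first.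
  apply/eqP; rewrite eq_le; apply/andP; split.
    by apply: ereal_inf_lbound; exists m.
  by apply: le_ereal_inf_tmp => _ [x _ <-]; rewrite lee_fin mP.
rewrite /= -[leRHS]mul1r -dq.2 mulr_suml; apply: ler_sum => x _.
by rewrite ler_wpM2l ?dq.1// lerN2 ler_ln ?posrE ?inner_sum_gt0// mP.
Qed.

(** Weak duality in [mu]: the Gibbs inequality for [mu > 0], and a mean bounded by a maximum for
    [mu = 0]. *)
Lemma cross_info_le_Gfun q p mu E : is_distr q -> is_distr p ->
  abs_cont P q -> kl_div P q <= E -> 0 <= mu ->
  cross_info d nu q p <= mu * E + Gfun d mu nu p P.
Proof.
move=> dq dp qP DE; rewrite le_eqVlt => /orP[/eqP<-|mu0].
  by rewrite mul0r add0r cross_info_le_Gfun0.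
rewrite cross_infoE Gfun_partition_fun//.
apply: le_trans (gibbs_variational dP _ mu0 dq qP) _.
by rewrite lerD2r ler_pM2l.
Qed.

Lemma inner_sum_cvg (T : Type) (F : set_system T) {FF : Filter F}
    (f : T -> Y -> R) p x :
  (forall y, f t y @[t --> F] --> p y) ->
  inner_sum d nu (f t) x @[t --> F] --> inner_sum d nu p x.
Proof. by move=> fp; apply: cvg_sum_fin => y; apply: cvgMr_tmp; exact: fp. Qed.

Lemma exp_neg_log_sum_cvg (T : Type) (F : set_system T) {FF : Filter F}
    (f : T -> Y -> R) p x mu : is_distr p ->
  (forall y, f t y @[t --> F] --> p y) ->
  expR (neg_log_sum (f t) x / mu) @[t --> F] --> expR (neg_log_sum p x / mu).
Proof.
move=> dp fp; apply: continuous_cvg; first exact: continuous_expR.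
apply: cvgMr_tmp; apply: cvgN; apply: continuous_cvg.
  exact/continuous_ln/inner_sum_gt0.
exact: inner_sum_cvg.
Qed.

(** A continuous function on a compact simplex. For [mu > 0] the minimiser also minimises G, which
    is mu ln of it. *)
Lemma partition_fun_minimizer mu : exists2 p, is_distr p &
  forall p', is_distr p' ->
    partition_fun P (neg_log_sum p) mu <= partition_fun P (neg_log_sum p') mu.
Proof.
have ne : ([set p | is_distr p] : set (prod_topology (fun _ : Y => R))) !=set0.
  by have [p0 dp0] := exists_distr; exists p0.
have [||p] := @compact_EVT_min (prod_topology (fun _ : Y => R)) R
    (fun p => partition_fun P (neg_log_sum p) mu) _ ne.
- exact: is_distr_compact.
- apply: continuous_in_subspaceT => p; rewrite inE => dp.
  apply: (@cvg_sum_fin _ _ (nbhs p) _ X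
    (fun x p' => P x * expR (neg_log_sum p' x / mu))
    (fun x => P x * expR (neg_log_sum p x / mu))) => x; apply: cvgMl_tmp.
  by apply: (@exp_neg_log_sum_cvg _ (nbhs p) _ id) => // y; exact: continuous_coord.
rewrite inE => dp pmin; exists p => // p' dp'; apply: pmin.
by rewrite inE.
Qed.

(* First-order optimality of [p] along the segment from [p] to the point mass at [y]. *)
Lemma minimizer_optimality mu p y : 0 < mu -> is_distr p ->
  (forall p', is_distr p' ->
    partition_fun P (neg_log_sum p) mu <= partition_fun P (neg_log_sum p') mu) ->
  \sum_x tilted P (neg_log_sum p) mu x
    * (expR (- (nu * d x y)) / inner_sum d nu p x) <= 1.
Proof.
move=> mu0 dp pmin.
pose r (t : R) (z : Y) : R := (1 - t) * p z + t * (z == y)%:R.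
have r0 z : r 0 z = p z by rewrite /r; ring.
have dr t : 0 < t <= 1 -> is_distr (r t).
  move=> /andP[t0 t1]; split=> [z|].
    by rewrite addr_ge0 ?mulr_ge0 ?dp.1 ?ler0n ?subr_ge0// ltW.
  rewrite big_split/= -!mulr_sumr dp.2 (bigD1 y)//= eqxx big1 => [|z /negbTE ->//].
  by rewrite addr0 !mulr1 subrK.
pose S t x := inner_sum d nu (r t) x.
pose k x := expR (- (nu * d x y)).
have SE t x : S t x = (1 - t) * inner_sum d nu p x + t * k x.
  rewrite /S /inner_sum /r; under eq_bigr do rewrite mulrDl -!mulrA.
  rewrite big_split/= -!mulr_sumr; congr (_ + _ * _).
  by rewrite (bigD1 y)//= eqxx mul1r big1 ?addr0// => z /negbTE ->; rewrite mul0r.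
(* Up to the factor t / mu, [A t] bounds from above the drop of the partition function from [r t] to
   [p]. Minimality of [p] makes it nonnegative, and only its limit as t tends to 0 from the right is
   needed, not a derivative. *)
pose A t := \sum_x P x * (expR (neg_log_sum (r t) x / mu)
  * ((inner_sum d nu p x - k x) / S t x)).
have A_ge0 t : 0 < t <= 1 -> 0 <= A t.
  move=> /[dup] t01 /andP[t0 t1].
  have : \sum_x P x * (expR (neg_log_sum (r t) x / mu)
      * (1 - (S t x)^-1 * t * (inner_sum d nu p x - k x) / mu))
      <= partition_fun P (neg_log_sum p) mu.
    apply: ler_sum => x _; rewrite ler_wpM2l ?dP.1//.
    have S0 : 0 < S t x by exact/inner_sum_gt0/dr.
    have I0 : 0 < inner_sum d nu p x by exact/inner_sum_gt0.
    have -> : neg_log_sum p x / mu = neg_log_sum (r t) x / mu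
        + - (ln (inner_sum d nu p x / S t x) / mu).
      by rewrite /neg_log_sum -/(S t x) ln_div ?posrE//; ring.
    rewrite expRD ler_wpM2l ?expR_ge0//; apply: le_trans (expR_ge1Dx _).
    rewrite lerD2l lerN2 ler_pM2r ?invr_gt0//.
    apply: le_trans (ln_le_sub1 (divr_gt0 I0 S0)) _.
    rewrite le_eqVlt; apply/orP; left; apply/eqP.
    have {1}-> : inner_sum d nu p x = S t x + t * (inner_sum d nu p x - k x).
      by rewrite SE; ring.
    by field; rewrite gt_eqF.
  move=> /le_trans/(_ (pmin _ (dr _ t01))).
  have -> : \sum_x P x * (expR (neg_log_sum (r t) x / mu)
      * (1 - (S t x)^-1 * t * (inner_sum d nu p x - k x) / mu)) =
      partition_fun P (neg_log_sum (r t)) mu - t / mu * A t.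
    rewrite /partition_fun /A mulr_sumr -sumrB; apply: eq_bigr => x _; ring.
  by rewrite gerBl pmulr_rge0// divr_gt0.
have rcvg z : r t z @[t --> (0 : R)^'+] --> p z.
  rewrite -r0; apply: cvg_at_right_filter; apply: cvgD.
    apply: cvgMr_tmp; apply: cvgB; [exact: cvg_cst|exact: cvg_id].
  by apply: cvgMr_tmp; exact: cvg_id.
have Acvg : A t @[t --> (0 : R)^'+] --> \sum_x P x * (expR (neg_log_sum p x / mu)
    * ((inner_sum d nu p x - k x) / inner_sum d nu p x)).
  apply: cvg_sum_fin => x; apply: cvgMl_tmp; apply: cvgM.
    exact: exp_neg_log_sum_cvg.
  apply: cvgMl_tmp; apply: cvgV; first by rewrite gt_eqF// inner_sum_gt0.
  exact: inner_sum_cvg.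
have := cvgr_to_ge Acvg; set L := \sum_x _.
have Z0 := partition_fun_gt0 dP (neg_log_sum p) mu.
have -> : L = partition_fun P (neg_log_sum p) mu * (1 -
    \sum_x tilted P (neg_log_sum p) mu x * (k x / inner_sum d nu p x)).
  rewrite -(tilted_is_distr dP (neg_log_sum p) mu).2 -sumrB mulr_sumr.
  apply: eq_bigr => x _; rewrite /tilted; field.
  by rewrite !gt_eqF// inner_sum_gt0.
move=> /(_ _ 0); rewrite pmulr_rge0// subr_ge0; apply.
near=> t; apply: A_ge0; apply/andP; split=> //.
near: t; exact: nbhs_right_le.
Unshelve. all: by end_near. Qed.

(** For [q] the tilted distribution of a minimiser [p], the left-hand side is F_nu(q, p). That [p]
    minimises F_nu(q, .) follows by averaging the optimality conditions over y with weights [p']. *)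
Lemma saddle_point mu : 0 < mu -> exists p q,
  [/\ is_distr p, is_distr q, abs_cont P q &
    forall p', is_distr p' ->
      mu * kl_div P q + Gfun d mu nu p P <= cross_info d nu q p'].
Proof.
move=> mu0; have [p dp pmin] := partition_fun_minimizer mu.
pose q := tilted P (neg_log_sum p) mu.
have dq : is_distr q by exact: tilted_is_distr.
exists p, q; split=> //; first exact: tilted_abs_cont.
move=> p' dp'; rewrite Gfun_partition_fun// -gibbs_variational_tilted//.
rewrite cross_infoE -subr_ge0 -sumrB.
(* Uses -ln u >= 1 - u with u the ratio of the two inner sums. *)
apply: (@le_trans _ _ (\sum_x (q x - q x * (inner_sum d nu p' x / inner_sum d nu p x)))).
  rewrite sumrB dq.2 subr_ge0.
  have -> : \sum_x q x * (inner_sum d nu p' x / inner_sum d nu p x) =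
    \sum_y p' y * \sum_x q x * (expR (- (nu * d x y)) / inner_sum d nu p x).
    under [RHS]eq_bigr do rewrite mulr_sumr.
    rewrite exchange_big/=; apply: eq_bigr => x _.
    rewrite /inner_sum mulr_suml mulr_sumr; apply: eq_bigr => y _; ring.
  rewrite -dp'.2; apply: ler_sum => y _.
  by rewrite -[leRHS]mulr1 ler_wpM2l ?dp'.1// minimizer_optimality.
apply: ler_sum => x _.
have I0 := inner_sum_gt0 d nu x dp; have I0' := inner_sum_gt0 d nu x dp'.
have := ler_wpM2l (dq.1 x) (ln_le_sub1 (divr_gt0 I0' I0)).
rewrite ln_div ?posrE// /neg_log_sum -/q; lra.
Qed.

(** Concave in q, being an infimum of functions linear in q. *)
Definition min_cross_info q : R := inf [set cross_info d nu q p | p in [set p | is_distr p]].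

Lemma min_cross_info_le q p : is_distr q -> is_distr p ->
  min_cross_info q <= cross_info d nu q p.
Proof.
move=> dq dp; apply: ge_inf; last by exists p.
by exists 0 => _ [p' dp' <-]; exact: cross_info_ge0.
Qed.

Lemma le_min_cross_info q c :
  (forall p, is_distr p -> c <= cross_info d nu q p) -> c <= min_cross_info q.
Proof.
move=> h; have [p dp] := exists_distr; apply: lb_le_inf.
  by exists (cross_info d nu q p), p.
by move=> _ [p' dp' <-]; exact: h.
Qed.

(** For [E > 0], [P] itself is strictly feasible. For [E = 0], a nearly optimal [p] against [P] is
    fixed and [mu] is taken large. *)
Lemma marton_multiplier (E c e : R) : 0 <= E -> 0 < e ->
  (forall q, is_distr q -> abs_cont P q -> kl_div P q <= E -> min_cross_info q <= c) ->
  exists mu p, [/\ 0 <= mu, is_distr p & mu * E + Gfun d mu nu p P <= c + e].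
Proof.
rewrite le_eqVlt => /orP[/eqP<-|E0] e0 hc.
  have e20 : 0 < e / 2 by rewrite divr_gt0.
  have [p dp hp] : exists2 p, is_distr p & cross_info d nu P p < c + e / 2.
    have [p0 dp0] := exists_distr.
    have [||_ [p dp <-] hp] := @inf_lt _ [set cross_info d nu P p | p in [set p | is_distr p]] (c + e / 2).
    - by exists (cross_info d nu P p0), p0.
    - apply: le_lt_trans (hc _ dP _ _) _; [by []|by rewrite kl_div_refl|].
      by rewrite ltrDl.
    - by exists p.
  have [mu mu0 hmu] := partition_fun_large_mu dP (fun x => neg_log_sum_ge0 x dp) e20.
  exists mu, p; split=> //; first exact: ltW.
  rewrite Gfun_partition_fun// mulr0 add0r; move: hmu; rewrite -cross_infoE; lra.
have [||||mu mu0 h] := @lagrange_multiplier R _ [set q | is_distr q /\ abs_cont P q]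
    (fun q => - min_cross_info q) (kl_div P) E (- c) P.
- move=> t q1 q2 /[dup] t01 /andP[t0 t1] [d1 ac1] [d2 ac2].
  have s0 : 0 <= 1 - t by rewrite subr_ge0.
  exists (fun x => t * q1 x + (1 - t) * q2 x).
    split=> [|x]; first split=> [x|].
    - by rewrite addr_ge0 ?mulr_ge0 ?d1.1 ?d2.1.
    - by rewrite big_split/= -!mulr_sumr d1.2 d2.2; ring.
    - apply: contraNneq => Px; have z q' : abs_cont P q' -> q' x = 0.
        by move=> ac; apply/eqP; apply: contraTT isT => /ac; rewrite Px eqxx.
      by rewrite !z// !mulr0 addr0.
  split; last exact: kl_div_convex.
  have -> : t * - min_cross_info q1 + (1 - t) * - min_cross_info q2
      = - (t * min_cross_info q1 + (1 - t) * min_cross_info q2) by ring.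
  rewrite lerN2; apply: le_min_cross_info => p dp.
  have -> : cross_info d nu (fun x => t * q1 x + (1 - t) * q2 x) p =
    t * cross_info d nu q1 p + (1 - t) * cross_info d nu q2 p.
    rewrite !cross_infoE !mulr_sumr -big_split/=; apply: eq_bigr => x _; ring.
  by apply: lerD; rewrite ler_wpM2l// min_cross_info_le.
- by split.
- by rewrite kl_div_refl.
- by move=> q [dq qP] DE; rewrite lerN2 hc.
(* The Lagrange multiplier may be 0, where no tilting is available; raising it by e / E costs at
   most [e]. *)
have mu'0 : 0 < mu + e / E by rewrite ltr_wpDl// divr_gt0.
have [p [q [dp dq qP pq]]] := saddle_point mu'0.
exists (mu + e / E), p; split=> //; first exact: ltW.
have hq := h _ (conj dq qP); have := le_min_cross_info pq.
have : 0 <= e / E * kl_div P q.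
  by apply: mulr_ge0 (kl_div_ge0 dP dq qP); rewrite divr_ge0// ltW.
have : e / E * E = e by rewrite divfK// gt_eqF.
lra.
Qed.

End Saddle.

(** * Assembling the two inequalities *)

Section DualityAux.
Set Implicit Arguments. Unset Strict Implicit.

Lemma maxmin_dist_eq0 (R : realType) (X Y : finType) (d : X -> Y -> R) :
  (0 < #|Y|)%N -> (forall x y, 0 <= d x y) -> maxmin_dist d = 0%E ->
  forall x, exists y, d x y = 0.
Proof.
move=> /card_gt0P[y0 _] d0 Hd x.
have [y _ yP] := @arg_minP _ R Y y0 xpredT (d x) isT.
exists y; apply/eqP; rewrite eq_le d0 andbT -lee_fin.
apply: (@le_trans _ _ (maxmin_dist d)); last by rewrite Hd.
apply: (@le_trans _ _ (ereal_inf [set (d x z)%:E | z in [set: Y]])).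
  by apply: le_ereal_inf_tmp => _ [z _ <-]; rewrite lee_fin yP.
by apply: ereal_sup_ubound; exists x.
Qed.

(** Weak duality in [nu]: evaluate the bound at the output distribution of each feasible channel. *)
Lemma rate_dist_ge_cross_info (R : realType) (X Y : finType) (d : X -> Y -> R)
    (q : X -> R) (nu Delta c : R) : 0 <= nu -> is_distr q ->
  (forall p, is_distr p -> c <= cross_info d nu q p) ->
  ((c - nu * Delta)%:E <= rate_dist d Delta q)%E.
Proof.
move=> nu0 dq hc; apply: le_ereal_inf_tmp => _ [V [cV dV] <-]; rewrite lee_fin.
have := hc _ (out_distr_is_distr dq cV).
move=> /le_trans /(_ (cross_info_le_info d nu dq cV)).
have := ler_wpM2l nu0 dV; lra.
Qed.

End DualityAux.

Theorem theorem1 (R : realType) (X Y : finType)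
    (HX : (0 < #|X|)%N) (HY : (0 < #|Y|)%N)
    (d : X -> Y -> R) (Hd0 : forall x y, 0 <= d x y)
    (Hd : maxmin_dist d = 0%E)
    (P : X -> R) (HP : is_distr P) (E Delta : R)
    (HE : 0 <= E) (HD0 : 0 <= Delta) (HDmax : (Delta%:E <= Delta_max d P)%E) :
  inv_marton d E Delta P = dual_expr d E Delta P.
Proof.
have d_eq0 := maxmin_dist_eq0 HY Hd0 Hd.
apply/eqP; rewrite eq_le; apply/andP; split.
- apply: ge_ereal_sup => _ [q [dq /(rel_entropy_le P)[qP DE]] <-].
  (* The zero-distortion channel is feasible, which excludes +oo. For a finite rate, the multiplier
     [nu] found for this [q] serves all [mu] and [p] at once. *)
  case rE : (rate_dist d Delta q) => [c| |]; last exact: leNye; last first.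
    have [V cV V0] := zero_distortion_channel d_eq0 q.
    have : (rate_dist d Delta q <= (mutual_info q V)%:E)%E.
      by apply: ereal_inf_lbound; exists V => //; rewrite /= V0.
    by rewrite rE.
  apply/lee_addgt0Pr => e e0.
  have cI V : is_cond_distr V -> avg_dist d q V <= Delta -> c <= mutual_info q V.
    by move=> cV dV; rewrite -lee_fin -rE; apply: ereal_inf_lbound; exists V.
  have [nu nu0 h] := rate_dist_multiplier Hd0 d_eq0 dq HD0 e0 HY cI.
  rewrite -leeBlDr// -EFinB; apply: le_trans; last first.
    by apply: ereal_sup_ubound; exists nu.
  apply: le_ereal_inf_tmp => _ [mu mu0 <-].
  rewrite addeC -leeBlDr// -EFinB; apply: le_ereal_inf_tmp => _ [p dp <-].
  rewrite lee_fin; have := h _ dp.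
  have := cross_info_le_Gfun d HP nu dq dp qP DE mu0; lra.
- apply: ge_ereal_sup => _ [nu nu0 <-].
  have lb q : is_distr q -> abs_cont P q -> kl_div P q <= E ->
      ((min_cross_info d nu q - nu * Delta)%:E <= inv_marton d E Delta P)%E.
    move=> dq qP DE; apply: (@le_trans _ _ (rate_dist d Delta q)).
      by apply: rate_dist_ge_cross_info => // p; exact: min_cross_info_le.
    by apply: ereal_sup_ubound; exists q => //; split=> //; apply/rel_entropy_le.
  (* [P] is feasible, which excludes -oo. A finite value m bounds [min_cross_info] by m + nu Delta
     on all feasible q, which is the input of [marton_multiplier]. *)
  case mE : (inv_marton d E Delta P) => [m| |]; first last.
  + have := lb P HP (fun _ Px => Px); rewrite kl_div_refl mE leeNy_eq.
    by move=> /(_ HE).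
  + exact: leey.
  apply/lee_addgt0Pr => e e0.
  have [|mu [p [mu0 dp hG]]] := @marton_multiplier R X Y d Hd0 P HP nu nu0 HY
      E (m + nu * Delta) e HE e0.
    move=> q dq qP DE; have := lb q dq qP DE.
    by rewrite mE lee_fin lerBlDr.
  apply: le_trans; first by apply: ereal_inf_lbound; exists mu.
  apply: le_trans.
    by apply: leeD2l; apply: ereal_inf_lbound; exists p.
  by rewrite -!EFinD lee_fin; lra.
Qed.
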